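(* There is an algorithm that, given a $P_4$-tidy graph $G$ with $n$ vertices, decides in $O(n)$ time whether $G$ is $2$-admissible.
   Context: All graphs are finite and simple. A tree $t$-spanner of a graph $G$ is a spanning tree $T$ of $G$ such that $d_T(u,v)\le t$ for every edge $uv$ of $G$. $G$ is $t$-admissible if it has a tree $t$-spanner. A graph $G$ is $P_4$-tidy if, for every induced path $P$ on four vertices in $G$, there is at most one vertex $v\in V(G)\setminus V(P)$ such that $G[V(P)\cup\{v\}]$ contains at least two induced $P_4$'s. *)

(* Defs.v *)
From mathcomp Require Import all_boot.

Set Implicit Arguments.
Unset Strict Implicit.
Unset Printing Implicit Defensive.

(* A finite simple graph is a symmetric irreflexive relation on a finType. *)

Section Graphs.
Variable T : finType.
Implicit Types (e f : rel T) (A B : {set T}).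

(* [ucycle] also accepts the degenerate cycles of size at most 2 (a vertex
   pair traversed back and forth); a cycle of a simple graph has size >= 3. *)
Definition acyclic e := forall p : seq T, ucycle e p -> size p <= 2.

Definition connected e := forall x y : T, connect e x y.

Definition is_tree e :=
  [/\ symmetric e, irreflexive e, connected e & acyclic e].

(* Number of edges of a shortest path from x to y; #|T| if there is none. *)
Definition gdist e (x y : T) : nat :=
  find (fun k => [exists p : k.-tuple T, path e x p && (last x p == y)])
       (iota 0 #|T|).

Definition tree_spanner (t : nat) e f :=
  [/\ is_tree f, subrel f e & forall u v, e u v -> gdist f u v <= t].

Definition admissible (t : nat) e := exists f : rel T, tree_spanner t e f.

(* An induced P4 is identified with its vertex set. *)
Definition induced_P4 e A : bool :=
  (#|A| == 4) &&
  [exists a, exists b, exists c, exists d,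
    [&& A == [set a; b; c; d], e a b, e b c, e c d,
        ~~ e a c, ~~ e a d & ~~ e b d]].

Definition P4_tidy e : Prop :=
  forall A, induced_P4 e A ->
    #|[set v | v \notin A
             & 2 <= #|[set B : {set T} | B \subset v |: A & induced_P4 e B]|]|
      <= 1.

End Graphs.

(* Word RAM.  Words are natural numbers below a modulus W = 2 ^ w.  There are
   registers and a memory with indirect addressing; the arithmetic is addition
   modulo W and truncated subtraction.  Programs are structured (no jumps). *)

Inductive expr :=
| ELit of nat
| EReg of nat
| EMem of expr
| EAdd of expr & expr
| ESub of expr & expr.

Inductive cmd :=
| CSkip
| CSetReg of nat & expr
| CSetMem of expr & expr
| CSeq of cmd & cmd
| CIf of expr & cmd & cmd
| CWhile of expr & cmd.

Record state := State { regs : nat -> nat; cells : nat -> nat }.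

Fixpoint eval (W : nat) (s : state) (a : expr) : nat :=
  match a with
  | ELit k => k %% W
  | EReg i => regs s i
  | EMem a1 => cells s (eval W s a1)
  | EAdd a1 a2 => (eval W s a1 + eval W s a2) %% W
  | ESub a1 a2 => eval W s a1 - eval W s a2
  end.

Definition upd (g : nat -> nat) (i v : nat) : nat -> nat :=
  fun j => if j == i then v else g j.

(* A configuration is the list of commands still to be executed together with
   the current state; the machine has halted when the list is empty.  A test is
   true when its value is nonzero.  Evaluating an expression counts as a single
   step: expressions are part of the program, so their size does not depend on
   the input. *)
Definition config := (seq cmd * state)%type.

Definition step (W : nat) (cf : config) : config :=
  let: (k, s) := cf in
  match k with
  | [::] => ([::], s)
  | CSkip :: k' => (k', s)
  | CSetReg i a :: k' => (k', State (upd (regs s) i (eval W s a)) (cells s))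
  | CSetMem a b :: k' =>
      (k', State (regs s) (upd (cells s) (eval W s a) (eval W s b)))
  | CSeq c1 c2 :: k' => ([:: c1, c2 & k'], s)
  | CIf a c1 c2 :: k' => ((if eval W s a != 0 then c1 else c2) :: k', s)
  | CWhile a c :: k' =>
      (if eval W s a != 0 then [:: c, CWhile a c & k'] else k', s)
  end.

Definition run (W t : nat) (P : cmd) (s : state) : config :=
  iter t (step W) ([:: P], s).

(* adj lists the neighbours of each vertex, in an arbitrary order. *)
Definition adjacency_lists n (e : rel 'I_n) (adj : 'I_n -> seq 'I_n) : Prop :=
  forall v, uniq (adj v) /\ (forall u, (u \in adj v) = e v u).

(* Adjacency lists stored in consecutive memory cells:
     cell 0              the number n of vertices;
     cell 1 + v (v < n)  the address of the first neighbour of v;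
     cell 1 + n          the address following the last neighbour of all;
     cells n + 2, ...    the lists of the vertices 0, 1, ..., n - 1, in turn.
   In particular the degree of v is the difference of cells 2 + v and 1 + v. *)
Definition encode n (adj : 'I_n -> seq 'I_n) : seq nat :=
  let lists := [seq map val (adj v) | v <- enum 'I_n] in
  n :: [seq n.+2 + sumn (take v (map size lists)) | v <- iota 0 n.+1]
    ++ flatten lists.

Definition input_state n (adj : 'I_n -> seq 'I_n) : state :=
  State (fun=> 0) (nth 0 (encode adj)).

(* The answer is read in register 0: nonzero for yes, zero for no. *)
Definition answers (cf : config) (Q : Prop) : Prop :=
  cf.1 = [::] /\ (regs cf.2 0 != 0 <-> Q).

(* Main.v *)
Require Import Defs.
From mathcomp Require Import all_boot.

(* Call c near universal if every other vertex is a neighbour of c or a leaf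
   whose neighbour is a neighbour of c.  Then a star at c with the remaining
   leaves hung on it is a tree 2-spanner.  Conversely, let f be a tree
   2-spanner of a P4-tidy graph and c a vertex of maximum degree.  If u is a
   neighbour of c and v a non-neighbour of c adjacent to u, then by maximality
   some neighbour w of c misses u, and f excludes the induced 4-cycle, so
   w-c-u-v is an induced P4.  If the vertices outside the closed neighbourhood
   of c are not all leaves attached to neighbours of c, this P4 has a partner,
   which by tidiness is its only one; this determines how every other vertex is
   attached and makes u near universal.

   To find a near universal vertex in O(n) steps without reading the edges,
   note that only the degrees and the neighbours of the leaves matter: c of
   degree other than 1 is near universal iff its degree plus the number of
   leaves attached to non-leaves other than c is n - 1. *)

Set Implicit Arguments.
Unset Strict Implicit.
Unset Printing Implicit Defensive.

(** * Induced P4's and their partners *)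

Section Partners.
Variables (T : finType) (e : rel T).
Hypotheses (e_sym : symmetric e) (e_irr : irreflexive e).

Definition near_universal (c : T) : Prop :=
  forall v, v != c -> e c v \/ exists2 u, e c u & e v =1 pred1 u.

Definition P4 a b c d :=
  [&& e a b, e b c, e c d, ~~ e a c, ~~ e a d & ~~ e b d].

(* The trace of x on the path a-b-c-d is neither empty, nor {b, c}, nor the
   whole path: these are the traces that create no second induced P4. *)
Definition partner a b c d x :=
  (x \notin [:: a; b; c; d]) &&
  [|| e x a != e x d, e x b != e x c | e x a && ~~ e x b].

Lemma edge_neq a b : e a b -> a != b.
Proof. by apply: contraTneq => ->; rewrite e_irr. Qed.

Lemma P4_uniq a b c d : P4 a b c d -> uniq [:: a; b; c; d].
Proof.
rewrite /P4; case/and5P=> ab bc cd ac /andP[ad bd]; rewrite /= !inE !negb_or andbT.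
rewrite (edge_neq ab) (edge_neq bc) (edge_neq cd) /= andbT; apply/andP; split; last first.
  by apply: contraNneq ad => <-.
apply/andP; split; first by apply: contraNneq ad => ->.
by apply: contraNneq bd => <-; rewrite e_sym.
Qed.

Lemma P4_set a b c d : P4 a b c d -> induced_P4 e [set a; b; c; d].
Proof.
move=> H; have U := P4_uniq H; apply/andP; split.
  have -> : [set a; b; c; d] = [set x in [:: a; b; c; d]].
    by apply/setP=> x; rewrite !inE -!orbA.
  by rewrite cardsE (card_uniqP _).
apply/existsP; exists a; apply/existsP; exists b.
by apply/existsP; exists c; apply/existsP; exists d; rewrite eqxx.
Qed.

(** Each of the thirteen remaining traces of [x] yields an induced P4 on [x] and three of [a], [b],
    [c], [d]; as it contains [x], it differs from the given one. *)
Lemma partner_set a b c d x : P4 a b c d -> partner a b c d x ->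
  x \in [set v | v \notin [set a; b; c; d] &
          2 <= #|[set B : {set T} | B \subset v |: [set a; b; c; d]
                                  & induced_P4 e B]|].
Proof.
move=> H /andP[xN tr]; have xS : x \notin [set a; b; c; d].
  by move: xN; rewrite !inE -!orbA.
rewrite inE xS /=.
have := P4_set H; set A := [set a; b; c; d] in xS * => HA.
suff [B [xB BA HB]] : exists B : {set T},
    [/\ x \in B, B \subset x |: A & induced_P4 e B].
  have AB : A != B by apply: contraNneq xS => ->.
  have <- : #|[set A; B]| = 2 by rewrite cards2 AB.
  apply/subset_leq_card/subsetP => C.
  by rewrite !inE => /orP[]/eqP->; rewrite ?BA ?subsetUr.
suff [p [q [r [s [/and5P[xB pA qA rA sA] HP]]]]] : exists p q r s,
    [&& x \in [:: p; q; r; s], p \in [:: x; a; b; c; d],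
     q \in [:: x; a; b; c; d], r \in [:: x; a; b; c; d] &
     s \in [:: x; a; b; c; d]] /\ P4 p q r s.
  exists [set p; q; r; s]; split; last exact: P4_set.
    by move: xB; rewrite !inE -!orbA.
  apply/subsetP => y; rewrite !inE -!orbA => /or4P[]/eqP-> {y};
    [move: pA|move: qA|move: rA|move: sA]; by rewrite !inE.
move: (H); rewrite /P4 => /and5P[ab bc cd ac /andP[ad bd]].
clear H HA xS xN A; move: tr; case xa: (e x a); case xb: (e x b); case xc: (e x c);
  case xd: (e x d) => //= _.
(* In the first four candidates [x] is an end; in the next two it takes the place of [b] or [c]; in
   the last two it joins [a] to [d]. *)
all: [> once (((exists x, a, b, c) + (exists x, b, c, d) + (exists x, c, b, a)
    + (exists x, d, c, b) + (exists a, x, c, d) + (exists d, x, b, a)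
    + (exists a, x, d, c) + (exists d, x, a, b));
   split; [by rewrite !inE !eqxx /= ?orbT|];
   rewrite /P4 ?(e_sym a x) ?(e_sym b x) ?(e_sym c x) ?(e_sym d x) ?(e_sym b a)
     ?(e_sym d a) ?(e_sym d b) ?(e_sym d c) ?(e_sym c b) ?(e_sym c a)
     ?(xa, xb, xc, xd) ?(ab, bc, cd) ?(negbTE ac) ?(negbTE ad) ?(negbTE bd); exact isT)..].
Qed.

Hypothesis tidy : P4_tidy e.

Lemma tidy_partner a b c d x y : P4 a b c d ->
  partner a b c d x -> partner a b c d y -> x = y.
Proof.
move=> H /(partner_set H) Hx /(partner_set H) Hy.
have /card_le1P := tidy (P4_set H).
by move/(_ _ Hx)/(_ y); rewrite Hy => /esym/eqP.
Qed.

End Partners.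

(** * Cuts and distances in a tree *)

Section Spanner.
Variables (T : finType) (f : rel T).
Hypothesis ftree : is_tree f.

(** [S] is the component of [x] once the edge [xy] is removed: a simple path still leading from [x]
    to [y] would close into a cycle with that edge. *)
Lemma tree_cut x y : f x y -> exists S : {set T},
  [/\ x \in S, y \notin S
    & forall a b, f a b -> a \in S -> b \notin S -> a = x /\ b = y].
Proof.
case: ftree => fsym firr _ acyc fxy.
pose g := [rel a b | f a b && ~~ ((a == x) && (b == y) || (a == y) && (b == x))].
have yS : ~~ connect g x y.
  apply/negP=> /connectP[p0 /shortenP[p gp Up _] yE].
  have /acyc /= : ucycle f (x :: p).
    rewrite /ucycle Up andbT /= rcons_path -yE (fsym y) fxy andbT.
    by apply: sub_path gp => a b /= /andP[].
  case: p gp Up yE => [|z [|//]] /=.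
    by move=> _ _ yx; rewrite yx firr in fxy.
  by rewrite andbT => /andP[_ gz] _ yz; rewrite yz !eqxx in gz.
exists [set a | connect g x a]; split; rewrite ?inE ?connect0 //.
move=> a b fab; rewrite !inE => Ha Hb.
case: (boolP (g a b)) => [gab|].
  by case/negP: Hb; apply: (connect_trans Ha); apply: connect1.
rewrite /= fab negbK /= => /orP[]/andP[/eqP aE /eqP bE] //.
by rewrite aE (negbTE yS) in Ha.
Qed.

(** Connectivity gives a simple path with fewer than [#|T|] edges, so the search in [gdist] succeeds
    and does not return its default. *)
Lemma gdist_path t x y : gdist f x y <= t ->
  exists2 p, path f x p & last x p = y /\ size p <= t.
Proof.
case: ftree => _ _ conn _; rewrite /gdist.
set P := fun k : nat => _; move=> le_t.
have hasP : has P (iota 0 #|T|).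
  have /connectP[p0 /shortenP[p fp Up _] yE] := conn x y.
  apply/hasP; exists (size p).
    by rewrite mem_iota add0n /= -[_.+1]/(size (x :: p)) -(card_uniqP Up) max_card.
  by apply/existsP; exists (in_tuple p); rewrite /= fp yE eqxx.
have := nth_find 0 hasP; rewrite nth_iota; last by move: hasP; rewrite has_find size_iota.
rewrite add0n => /existsP[p /andP[fp /eqP yE]].
by exists p; rewrite // size_tuple.
Qed.
End Spanner.

Lemma path_gdist (T : finType) (f : rel T) x (p : seq T) :
  path f x p -> size p < #|T| -> gdist f x (last x p) <= size p.
Proof.
move=> fp ltp; rewrite /gdist leqNgt; apply/negP => /(before_find 0).
rewrite nth_iota // add0n => /existsP[]; exists (in_tuple p).
by rewrite /= fp eqxx.
Qed.

(** * Tree 2-spanners *)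

Section Necessity.
Variables (T : finType) (e f : rel T).
Hypotheses (e_sym : symmetric e) (e_irr : irreflexive e).
Hypothesis span : tree_spanner 2 e f.

Lemma f_sym : symmetric f. Proof. by case: span => [[]]. Qed.
Lemma f_irr : irreflexive f. Proof. by case: span => [[]]. Qed.
Lemma f_e u v : f u v -> e u v. Proof. by case: span => _ + _; apply. Qed.

Lemma spanner_edge u v : e u v -> f u v \/ exists2 m, f u m & f m v.
Proof.
case: span => ftree _ dist euv.
have [[|a [|b [|? ?]]] /= fp [lastp le2]] := gdist_path ftree (dist _ _ euv) => //.
- by rewrite lastp e_irr in euv.
- by left; rewrite -lastp; case/andP: fp.
- by right; exists a; rewrite -?lastp; case/and3P: fp.
Qed.

(** An edge of [e] across the fundamental cut of [xy] has its ends joined by a tree path of length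
    at most 2, and that path must use [xy]. *)
Lemma spanner_cut x y : f x y -> exists S : {set T},
  [/\ x \in S, y \notin S,
      forall a b, f a b -> a \in S -> b \notin S -> a = x /\ b = y
    & forall a b, e a b -> a \in S -> b \notin S ->
        [\/ a = x /\ b = y, b = y /\ f a x | a = x /\ f y b]].
Proof.
case: (span) => ftree _ _ fxy; have [S [xS yS cut]] := tree_cut ftree fxy.
exists S; split=> // a b /spanner_edge[fab|[m fam fmb]] aS bS.
  by constructor 1; apply: cut.
have [mS|mS] := boolP (m \in S).
  by have [mE bE] := cut _ _ fmb mS bS; constructor 2; rewrite -mE.
by have [aE mE] := cut _ _ fam aS mS; constructor 3; rewrite -mE.
Qed.

Lemma path_cross (S : {set T}) a s : path e a s -> a \in S -> last a s \notin S ->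
  exists p q, [/\ e p q, p \in S, q \notin S, p \in a :: s & q \in a :: s].
Proof.
elim: s a => [|b s IH] a /=; first by move=> _ ->.
case/andP=> eab es aS lS; have [bS|bS] := boolP (b \in S).
  have [p [q [epq pS qS ps qs]]] := IH _ es bS lS.
  by exists p, q; split=> //; rewrite inE ?ps ?qs orbT.
by exists a, b; split=> //; rewrite !inE eqxx ?orbT.
Qed.

(** Stands for a path from [a] to [c] that avoids [b] and has no inner vertex adjacent to [b], seen
    through the cuts it crosses. *)
Definition linked_off b a c := forall S : {set T}, (a \in S) != (c \in S) ->
  exists p q, [/\ e p q, p \in S & q \notin S] /\
    forall r, r \in [:: p; q] -> r != b /\ (e b r -> r = a \/ r = c).

Lemma linked_off_sym b a c : linked_off b a c -> linked_off b c a.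
Proof.
move=> L S; rewrite eq_sym => /L[p [q [H Hr]]].
by exists p, q; split=> // r /Hr[? Hr']; split=> // /Hr' []; [right|left].
Qed.

Lemma path_linked_off b a s : path e a s ->
  (forall r, r \in a :: s -> r != b /\ (e b r -> r = a \/ r = last a s)) ->
  linked_off b a (last a s).
Proof.
move=> es Hr S; have [aS|aS] := boolP (a \in S) => lS.
  have {}lS : last a s \notin S by case: (_ \in S) lS.
  have [p [q [epq pS qS ps qs]]] := path_cross es aS lS.
  by exists p, q; split=> // r; rewrite !inE => /orP[]/eqP->; apply: Hr.
have {}lS : last a s \notin ~: S by rewrite inE negbK; case: (_ \in S) lS.
have [|p [q [epq pS qS ps qs]]] := path_cross es _ lS; first by rewrite inE.
exists q, p; split; first by rewrite e_sym; move: pS qS; rewrite !inE negbK.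
by move=> r; rewrite !inE => /orP[]/eqP->; apply: Hr.
Qed.

(** Take the cut of a supposed tree edge [ab]. If [c] is on the side of [a], the edge [cb] forces
    [ca] into the tree. Otherwise the link crosses the cut, which it can do only from [a] to a
    neighbour of [b], that is, to [c]; but [a] and [c] are not adjacent. *)
Lemma linked_off_not_tree a b c : e b c -> ~~ e a c -> a != c ->
  linked_off b a c -> ~~ f a b.
Proof.
move=> ebc nac ac L; apply/negP=> fab.
have [S [aS bS _ cut]] := spanner_cut fab.
have [cS|cS] := boolP (c \in S).
  rewrite e_sym in ebc.
  case: (cut _ _ ebc cS bS) => -[E]; first by rewrite E eqxx in ac.
    by move/f_e; rewrite e_sym (negbTE nac).
  by rewrite E eqxx in ac.
have [|p [q [[epq pS qS] Hr]]] := L S; first by rewrite aS (negbTE cS).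
have [|qb qac] := Hr q; first by rewrite !inE eqxx orbT.
case: (cut _ _ epq pS qS) => -[E F]; first by rewrite F eqxx in qb.
  by rewrite E eqxx in qb.
have [qE|qE] := qac (f_e F); first by rewrite qE aS in qS.
by rewrite E qE (negbTE nac) in epq.
Qed.

(* Three consecutive vertices of an induced cycle of length at least 4 have a
   common neighbour in the spanner. *)
Lemma induced_cycle_hub a b c : e a b -> e b c -> ~~ e a c -> a != c ->
  linked_off b a c -> exists z, [/\ f z a, f z b & f z c].
Proof.
move=> eab ebc nac ac L.
have nab := linked_off_not_tree ebc nac ac L.
have ncb : ~~ f c b.
  by apply: (@linked_off_not_tree _ _ a); rewrite 1?e_sym 1?eq_sym //;
    apply: linked_off_sym.
case: (spanner_edge eab) => [|[m fam fmb]]; first by rewrite (negbTE nab).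
case: (spanner_edge ebc) => [|[m' fbm' fm'c]]; first by rewrite f_sym (negbTE ncb).
(* If the tree paths [a-m-b] and [b-m'-c] had distinct middles, the cut of [mb] would separate [a]
   from [c], and the link could cross it only along [mc] with [bc] a tree edge. *)
have [E|mm'] := eqVneq m m'.
  by exists m; rewrite {1}f_sym fam fmb E.
have [S [mS bS fcut cut]] := spanner_cut fmb.
have aS : a \in S.
  apply: contraT => aS; rewrite f_sym in fam.
  have [_ aE] := fcut _ _ fam mS aS.
  by move: eab; rewrite aE e_irr.
have m'S : m' \notin S.
  apply/negP => m'S; rewrite f_sym in fbm'.
  by have [E _] := fcut _ _ fbm' m'S bS; rewrite E eqxx in mm'.
have cS : c \notin S.
  apply/negP => cS; rewrite f_sym in fm'c.
  have [_ E] := fcut _ _ fm'c cS m'S.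
  by move: fbm'; rewrite E f_irr.
have [|p [q [[epq pS qS] Hr]]] := L S; first by rewrite aS (negbTE cS).
have [|qb qac] := Hr q; first by rewrite !inE eqxx orbT.
case: (cut _ _ epq pS qS) => -[E F]; first by rewrite F eqxx in qb.
  by rewrite E eqxx in qb.
have [qE|qE] := qac (f_e F); first by rewrite qE aS in qS.
by rewrite qE f_sym (negbTE ncb) in F.
Qed.

(** The cut of the tree edge [cz] has [w] on the side of [c] and [x] on the side of [z]; every edge
    across it has [c] or [z] as an end. *)
Lemma private_neighbor z c w x : f z c -> e c w -> w != z -> ~~ e z w ->
  f z x -> x != c -> ~~ e w x /\ w != x.
Proof.
move=> fzc ecw wz nzw fzx xc; rewrite f_sym in fzc.
have [S [cS zS fcut cut]] := spanner_cut fzc.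
have xS : x \notin S.
  apply/negP => xS; rewrite f_sym in fzx.
  by have [E _] := fcut _ _ fzx xS zS; rewrite E eqxx in xc.
have wS : w \in S.
  apply: contraT => wS; case: (cut _ _ ecw cS wS) => -[_ E].
  - by rewrite E eqxx in wz.
  - by rewrite f_irr in E.
  - by rewrite (f_e E) in nzw.
split; last by apply: contraNneq xS => <-.
apply/negP => ewx; case: (cut _ _ ewx wS xS) => -[E F].
- by rewrite E e_irr in ecw.
- by rewrite E f_irr in fzx.
- by rewrite E e_irr in ecw.
Qed.

(* Two common neighbours u, y of c and v force one of them, z, to be the
   neighbour of c in the spanner towards v. *)
Lemma common_neighbors_hub c v u y : c != v -> ~~ e c v -> u != y ->
  e c u -> e c y -> e v u -> e v y ->
  exists z, [/\ f z c, e v z & forall x, e c x -> e v x -> x = z \/ f z x].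
Proof.
move=> cv ncv uy ecu ecy evu evy.
(* [z] is the vertex after [c] on the tree path from [c] to [u]. *)
have [z [fcz zu]] : exists z, f c z /\ (u = z \/ f z u).
  case: (spanner_edge ecu) => [|[m]]; first by exists u; split=> //; left.
  by exists m; split=> //; right.
have [S [cS zS fcut cut]] := spanner_cut fcz.
have uc : u != c by rewrite eq_sym (edge_neq e_irr).
have uS : u \notin S.
  case: zu => [->//|fzu]; apply/negP=> uS; rewrite f_sym in fzu.
  by have [E _] := fcut _ _ fzu uS zS; rewrite E eqxx in uc.
have vS : v \notin S.
  apply/negP => vS; case: (cut _ _ evu vS uS) => -[E F].
  - by rewrite E eqxx in cv.
  - by move/f_e: F; rewrite e_sym (negbTE ncv).
  - by rewrite E eqxx in cv.
have Uz x : e c x -> e v x -> x = z \/ f z x.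
  move=> ecx evx; have xS : x \notin S.
    apply/negP => xS; rewrite e_sym in evx.
    case: (cut _ _ evx xS vS) => -[E F].
    - by rewrite E e_irr in ecx.
    - by rewrite E (f_e fcz) in ncv.
    - by rewrite E e_irr in ecx.
  by case: (cut _ _ ecx cS xS) => -[E F]; [left|rewrite f_irr in F|right].
exists z; split=> //; first by rewrite f_sym.
(* If [z] is neither [u] nor [y], the edge [uv] crosses the cut of the tree edge [uz], which forces
   [zv] into the tree. *)
have [<-//|fzu] := Uz u ecu evu; have [<-//|fzy] := Uz y ecy evy.
rewrite f_sym in fzu.
have [S' [uS' zS' fcut' cut']] := spanner_cut fzu.
have yS' : y \notin S'.
  apply/negP => yS'; rewrite f_sym in fzy.
  by have [E _] := fcut' _ _ fzy yS' zS'; rewrite E eqxx in uy.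
have vu : v != u by rewrite (edge_neq e_irr).
have vS' : v \notin S'.
  apply/negP => vS'; case: (cut' _ _ evy vS' yS') => -[E F].
  - by rewrite E eqxx in vu.
  - by rewrite E f_irr in fzy.
  - by rewrite E eqxx in vu.
rewrite e_sym in evu; rewrite e_sym.
case: (cut' _ _ evu uS' vS') => -[E F].
- by rewrite F (f_e fcz) in ncv.
- by rewrite f_irr in F.
- exact: f_e.
Qed.

Lemma connected_closed (A : {set T}) x0 : x0 \in A ->
  (forall x y, x \in A -> e x y -> y \in A) -> forall y, y \in A.
Proof.
case: span => [[_ _ conn _] fe _] x0A clA y.
have /connectP[p fp ->] := conn x0 y.
elim: p x0 x0A fp => //= a p IH x0 x0A /andP[/fe ea]; apply: IH.
exact: clA ea.
Qed.
End Necessity.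

(** * 2-admissible P4-tidy graphs *)

Section Classification.
Variables (T : finType) (e : rel T).
Hypotheses (e_sym : symmetric e) (e_irr : irreflexive e).

Ltac edge_contra := match goal with
  | H : is_true (e ?x ?x) |- _ => by rewrite e_irr in H
  | H : is_true (?x != ?x) |- _ => by rewrite eqxx in H
  | H : is_true (e ?x ?y), H' : is_true (~~ e ?x ?y) |- _ => by rewrite H in H'
  | H : is_true (e ?x ?y), H' : is_true (~~ e ?y ?x) |- _ =>
      by rewrite e_sym H in H'
  end.

Ltac neq := first [assumption | by rewrite eq_sym |
  apply/eqP => ?; subst; edge_contra].

Ltac edges := repeat match goal with
  | H : is_true (e ?x ?y) |- context [e ?x ?y] => rewrite H
  | H : is_true (e ?x ?y) |- context [e ?y ?x] => rewrite [e y x]e_sym H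
  | H : is_true (~~ e ?x ?y) |- context [e ?x ?y] => rewrite (negbTE H)
  | H : is_true (~~ e ?x ?y) |- context [e ?y ?x] =>
      rewrite [e y x]e_sym (negbTE H)
  | |- context [e ?x ?x] => rewrite e_irr
  end.

Ltac notin := rewrite !inE !negb_or ?andbT; do !(apply/andP; split); neq.
Ltac p4 := rewrite /P4; edges; exact isT.
Ltac partners := apply/andP; split; [notin | edges; rewrite ?orbT; exact isT].

Hypothesis tidy : P4_tidy e.

(** As [p] is the only partner, [x] keeps one of the three harmless traces: empty, [{b, c}] or the
    whole path. *)
Lemma tidy_trace a b c d p x : P4 e a b c d -> partner e a b c d p ->
  x \notin [:: a; b; c; d; p] ->
  [/\ e x a = e x d, e x b = e x c & e x a -> e x b].
Proof.
move=> H Hp xN; have : ~~ partner e a b c d x.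
  apply: contra xN => Hx.
  by rewrite (tidy_partner e_sym e_irr tidy H Hx Hp) !inE eqxx !orbT.
have -> : partner e a b c d x =
    [|| e x a != e x d, e x b != e x c | e x a && ~~ e x b].
  rewrite /partner; case: (boolP (x \notin _)) => //= xN'.
  by case/negP: xN'; move: xN; rewrite !inE !negb_or => /and5P[-> -> -> ->].
rewrite !negb_or !negbK negb_and negbK => /and3P[/eqP-> /eqP->].
by move=> H'; split=> // xd; rewrite xd in H'.
Qed.

(* A non-neighbour m of c outside the list hangs on some x; a second neighbour
   y of m would be a second partner, besides p, of the path m-x-u-v. *)
Lemma near_universal_endgame c w u v p :
  e c w -> e c u -> e u v -> e u p -> e v p ->
  ~~ e w u -> ~~ e w v -> ~~ e w p -> ~~ e c v ->
  (forall x, x \notin [:: w; c; u; v; p] ->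
     [/\ ~~ e x w, ~~ e x v, e x u = e x c & e x p -> e x c]) ->
  (forall m, m != c -> ~~ e c m -> exists2 x, e c x & e x m) ->
  near_universal e u.
Proof.
move=> cw cu uv up vp nwu nwv nwp ncv Hx ecc m mu.
have [|mL] := boolP (m \in [:: w; c; u; v; p]).
  rewrite !inE (negbTE mu) /= => /or4P[]/eqP E; subst m;
    try by left; first [by [] | by rewrite e_sym].
  right; exists c => [|x]; first by rewrite e_sym.
  have [|xL] := boolP (x \in [:: w; c; u; v; p]); last first.
    have [xw _ _ _] := Hx x xL; edges; apply/esym; apply: contraNF xL => /eqP->.
    by rewrite !inE eqxx orbT.
  rewrite !inE => /or4P[|||/orP[]] /eqP->; edges; rewrite ?eqxx //;
    by apply/esym/negbTE; neq.
have [mw mv muc mp] := Hx m mL.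
have [cm|ncm] := boolP (e c m); first by left; rewrite e_sym muc e_sym.
have mc : m != c by move: mL; rewrite !inE !negb_or => /and5P[].
have [x cx xm] := ecc m mc ncm; right; exists x.
  have [|xL] := boolP (x \in [:: w; c; u; v; p]).
    rewrite !inE => /or4P[|||/orP[]] /eqP E; subst x; try edge_contra.
    - by move: xm; rewrite e_sym muc e_sym (negbTE ncm).
    - by move: xm; rewrite e_sym => /mp; rewrite e_sym (negbTE ncm).
  by have [_ _ xu _] := Hx x xL; rewrite e_sym xu e_sym.
have xL : x \notin [:: w; c; u; v; p].
  apply/negP; rewrite !inE => /or4P[|||/orP[]] /eqP E; subst x; try edge_contra.
  - by move: xm; rewrite e_sym muc e_sym (negbTE ncm).
  - by move: xm; rewrite e_sym => /mp; rewrite e_sym (negbTE ncm).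
have nmu : ~~ e m u by rewrite muc e_sym.
have nmp : ~~ e m p by apply: contra ncm => /mp; rewrite e_sym.
have [xw xv xuc _] := Hx x xL.
have xu : e x u by rewrite xuc e_sym.
move=> y /=; have [->|yx] := eqVneq y x; first by rewrite e_sym.
apply/negP => my.
have yL : y \notin [:: w; c; u; v; p].
  by apply/negP; rewrite !inE => /or4P[|||/orP[]] /eqP E; subst y; edge_contra.
have [yw yv _ _] := Hx y yL.
have H : P4 e m x u v by p4.
have Ep : p = y.
  have xp : x != p by move: xL; rewrite !inE !negb_or => /and5P[].
  have yu : y != u by move: yL; rewrite !inE !negb_or => /and5P[].
  by apply: (tidy_partner e_sym e_irr tidy H); partners.
by rewrite Ep !inE eqxx !orbT in yL.
Qed.

(** Otherwise the closed neighbourhood of [u] would contain that of [c] and also [v], and [u] would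
    have larger degree than [c]. *)
Lemma max_degree_private c u v :
  (forall x, #|[set y | e x y]| <= #|[set y | e c y]|) ->
  e c u -> e u v -> v != c -> ~~ e c v ->
  exists w, [/\ e c w, w != u & ~~ e u w].
Proof.
move=> cmax cu uv vc ncv.
have [|] := boolP [exists w, [&& e c w, w != u & ~~ e u w]].
  by case/existsP=> w /and3P[]; exists w.
rewrite negb_exists => /forallP all_u.
suff : #|c |: (v |: [set y | e c y])| <= #|u |: [set y | e u y]|.
  rewrite !cardsU1 !inE e_irr (negbTE ncv) orbF eq_sym vc e_irr.
  by move/leq_trans/(_ (leq_add (leqnn _) (cmax u))); rewrite !addnA ltnn.
apply/subset_leq_card/subsetP => y; rewrite !inE => /or3P[/eqP->|/eqP->|cy].
- by rewrite (e_sym u) cu orbT.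
- by rewrite uv orbT.
- by have := all_u y; rewrite cy /= negb_and !negbK.
Qed.

Variable f : rel T.
Hypothesis span : tree_spanner 2 e f.

(** Four cases for [c] of maximum degree: a vertex at distance 3 from [c]; a non-neighbour of [c]
    with two neighbours in common with [c]; two adjacent non-neighbours of [c]; none of these. In
    the first three the witness is a neighbour [u] of [c], in the last it is [c]. *)
Lemma near_universal_exists (x0 : T) : exists c, near_universal e c.
Proof.
pose deg x := #|[set y | e x y]|.
have [c cmax] : exists c, forall x, deg x <= deg c.
  by case: (@arg_maxnP T x0 predT deg) => // c _ H; exists c => x; apply: H.
have private := max_degree_private cmax.
(* The hub z of an induced C4 c-u-v-w has a private neighbour w' at c, and
   then w and z are two partners of w'-c-u-v. *)
have no_C4 u v w : e c u -> e u v -> v != c -> ~~ e c v ->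
    e c w -> w != u -> ~~ e u w -> ~~ e v w.
  move=> cu uv vc ncv cw wu nuw; apply/negP=> vw.
  have [z [zc zu zv]] : exists z, [/\ f z c, f z u & f z v].
    apply: (induced_cycle_hub e_sym e_irr span) => //; first by neq.
    apply: (@path_linked_off _ _ e_sym u c [:: w; v]).
      by rewrite /=; edges.
    move=> r; rewrite !inE => /or3P[]/eqP->; split;
      by [neq|move=> _; left|move=> _; right|rewrite (negbTE nuw)].
  have fe := f_e span.
  have cz : e c z by rewrite e_sym fe.
  have [w' [cw' w'z nzw']] := private z v cz (fe _ _ zv) vc ncv.
  have [|nw'u w'u] := private_neighbor e_irr span zc cw' w'z nzw' zu; first by neq.
  have [|nw'v w'v] := private_neighbor e_irr span zc cw' w'z nzw' zv; first by neq.
  have H : P4 e w' c u v by p4.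
  move/fe: zu => zu; move/fe: zv => zv.
  suff E : w = z by subst w; edge_contra.
  by apply: (tidy_partner e_sym e_irr tidy H); partners.
pose B := [set x | [|| x == c, e c x | [exists y, e c y && e y x]]].
(* If some vertex is at distance 3 from c, the graph is a P5 with centre u. *)
have [|] := boolP [forall x, forall y, (x \in B) && e x y ==> (y \in B)]; last first.
  rewrite negb_forall => /existsP[v]; rewrite negb_forall => /existsP[t].
  rewrite negb_imply => /andP[/andP[vB vt]].
  rewrite !inE !negb_or negb_exists => /and3P[tc nct /forallP far].
  have nvc : v != c by neq.
  have ncv : ~~ e c v by have := far v; rewrite vt andbT.
  move: vB; rewrite inE (negbTE nvc) (negbTE ncv) /= => /existsP[u /andP[cu uv]].
  have [w [cw wu nuw]] := private u v cu uv nvc ncv.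
  have nvw := no_C4 u v w cu uv nvc ncv cw wu nuw.
  have nut : ~~ e u t by have := far u; rewrite cu.
  have nwt : ~~ e w t by have := far w; rewrite cw.
  have H1 : P4 e w c u v by p4.
  have H2 : P4 e c u v t by p4.
  have p1 : partner e w c u v t by partners.
  have p2 : partner e c u v t w by partners.
  (* The partners [t] of [w-c-u-v] and [w] of [c-u-v-t] make [x] adjacent to all five vertices or to
     none; all is excluded, since [t] is too far from [c]. *)
  have isolated x : x \notin [:: w; c; u; v; t] ->
      [/\ ~~ e x w, ~~ e x c, ~~ e x u, ~~ e x v & ~~ e x t].
    move=> xL; have [xwv xcu xwc] := tidy_trace H1 p1 xL.
    have [|xct xuv _] := tidy_trace H2 p2 (x := x).
      by move: xL; rewrite !inE !negb_or => /and5P[-> -> -> -> ->]; exact: isT.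
    have nxt : ~~ e x t.
      by apply/negP => xt; have := far x; rewrite e_sym xct xt.
    by rewrite xwv -xuv -xcu xct.
  have L y : y \in [:: w; c; u; v; t].
    suff : y \in [set z in [:: w; c; u; v; t]] by rewrite inE.
    apply: (connected_closed span (x0 := c)) => [|p q]; rewrite !inE ?eqxx ?orbT //.
    move=> pL pq; apply: contraT => qL.
    have := isolated q; rewrite !inE => /(_ qL)[? ? ? ? ?].
    by move: pL => /or4P[|||/orP[]] /eqP E; subst p; edge_contra.
  exists u => m mu; have := L m.
  rewrite !inE (negbTE mu) /= => /or4P[]/eqP E; subst m;
    try by left; first [by [] | by rewrite e_sym].
    right; exists c => [|x]; first by rewrite e_sym.
    have := L x; rewrite !inE => /or4P[|||/orP[]] /eqP->; edges; rewrite /= ?eqxx //;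
    by apply/esym/negbTE; neq.
  right; exists v => [//|x].
  have := L x; rewrite !inE => /or4P[|||/orP[]] /eqP->; edges; rewrite /= ?eqxx //;
    by apply/esym/negbTE; neq.
move=> /forallP clB.
have ecc m : m != c -> ~~ e c m -> exists2 x, e c x & e x m.
  move=> mc ncm; have : m \in B.
    apply: (connected_closed span (x0 := c)) => [|x y xB xy].
      by rewrite inE eqxx.
    by have /forallP/(_ y)/implyP := clB x; apply; rewrite xB.
  by rewrite inE (negbTE mc) (negbTE ncm) => /existsP[x /andP[]]; exists x.
pose twice v u y := [&& v != c, ~~ e c v, u != y, e c u, e c y, e u v & e y v].
have [|no_twice] := boolP [exists v, exists u, exists y, twice v u y].
  case/existsP=> v /existsP[u /existsP[y]].
  case/and5P=> vc ncv uy cu /and3P[cy uv yv].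
  have uy' : e u y.
    apply: contraT => nuy; rewrite eq_sym in uy.
    have := no_C4 u v y cu uv vc ncv cy uy nuy.
    by rewrite e_sym yv.
  have cv : c != v by neq.
  have vu : e v u by rewrite e_sym.
  have vy : e v y by rewrite e_sym.
  have [z [zc vz Uz]] := common_neighbors_hub e_sym e_irr span cv ncv uy cu cy vu vy.
  have cz : e c z by rewrite e_sym (f_e span).
  rewrite e_sym in vz.
  have [w [cw wz nzw]] := private z v cz vz vc ncv.
  have nvw := no_C4 z v w cz vz vc ncv cw wz nzw.
  (* Chosen to miss the hub [z], [w] misses every common neighbour of [c] and [v], because each of
     them is [z] or a tree neighbour of [z]. *)
  have wU x : e c x -> e v x -> ~~ e w x.
    move=> cx vx; have [->|zx] := Uz x cx vx; first by rewrite e_sym.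
    have xc : x != c by neq.
    by case: (private_neighbor e_irr span zc cw wz nzw zx xc).
  have nwu : ~~ e w u by apply: wU; rewrite // e_sym.
  have nwy : ~~ e w y by apply: wU; rewrite // e_sym.
  exists u.
  have H1 : P4 e w c u v by p4.
  have H2 : P4 e w c y v by p4.
  have p1 : partner e w c u v y by partners.
  have p2 : partner e w c y v u by partners.
  apply: (near_universal_endgame cw cu uv uy' _ nwu _ nwy ncv _ ecc);
    rewrite 1?e_sym // => x xL.
  have [xwv xcu xwc] := tidy_trace H1 p1 xL.
  have [|_ xcy _] := tidy_trace H2 p2 (x := x).
    move: xL; rewrite !inE !negb_or => /and5P[-> -> -> -> ->]; exact: isT.
  (* A neighbour [x] of [v] would be adjacent to [w], hence to [c], against [wU]. *)
  have nxv : ~~ e x v.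
    apply/negP => xv; have xw : e x w by rewrite xwv.
    by have := wU x; rewrite e_sym xwc // e_sym xv e_sym xw => /(_ isT isT).
  by split; rewrite ?xwv -?xcu -?xcy.
have unique v u y : v != c -> ~~ e c v -> e c u -> e c y -> e u v -> e y v -> u = y.
  move=> vc ncv cu cy uv yv; apply/eqP; apply: contraNT no_twice => uy.
  apply/existsP; exists v; apply/existsP; exists u; apply/existsP; exists y.
  by rewrite /twice vc ncv uy cu cy uv yv.
pose far_edge v v' := [&& v != c, ~~ e c v, v' != c, ~~ e c v' & e v v'].
have [|no_far] := boolP [exists v, exists v', far_edge v v'].
  case/existsP=> v /existsP[v' /and5P[vc ncv v'c ncv' vv']].
  have [u cu uv] := ecc v vc ncv; have [u' cu' uv'] := ecc v' v'c ncv'.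
  (* Otherwise [u-u'-v'-v] is an induced C4 or, with [c], the five vertices form an induced C5; the
     hub of either cycle contradicts [unique]. *)
  have E : u = u'.
    apply/eqP; apply: contraT => uu'.
    have nuv' : ~~ e u v'.
      by apply: contra uu' => uv2; apply/eqP/(unique v').
    have nuv : ~~ e u' v.
      by apply: contra uu' => uv2; apply/eqP/(unique v).
    have [euu|neuu] := boolP (e u u').
      have [z [zv' zu' zu]] : exists z, [/\ f z v', f z u' & f z u].
        apply: (induced_cycle_hub e_sym e_irr span); rewrite 1?e_sym //; first by neq.
        apply: (@path_linked_off _ _ e_sym u' v' [:: v; u]).
          by rewrite /=; edges.
        move=> r; rewrite !inE => /or3P[]/eqP->; split;
          by [neq|move=> _; left|move=> _; right|rewrite (negbTE nuv)].
      have fe := f_e span; have zc : z != c.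
        by apply: contraNneq ncv' => <-; apply: fe.
      have [cz|ncz] := boolP (e c z).
        have E := unique v' z u' v'c ncv' cz cu' (fe _ _ zv') uv'.
        by rewrite E (f_irr span) in zu'.
      by rewrite (unique z u u') // ?eqxx // in uu'; rewrite e_sym fe.
    have [z [zc zu zv]] : exists z, [/\ f z c, f z u & f z v].
      apply: (induced_cycle_hub e_sym e_irr span) => //; first by neq.
      apply: (@path_linked_off _ _ e_sym u c [:: u'; v'; v]).
        by rewrite /=; edges.
      by move=> r; rewrite !inE => /or4P[]/eqP->; split;
        by [neq|move=> _; left|move=> _; right|rewrite (negbTE nuv')|rewrite (negbTE neuu)].
    have fe := f_e span; have cz : e c z by rewrite e_sym fe.
    have E := unique v z u vc ncv cz cu (fe _ _ zv) uv.
    by rewrite E (f_irr span) in zu.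
  subst u'; exists u.
  have [w [cw wu nuw]] := private u v cu uv vc ncv.
  have nvw := no_C4 u v w cu uv vc ncv cw wu nuw.
  have nvw' := no_C4 u v' w cu uv' v'c ncv' cw wu nuw.
  have H1 : P4 e w c u v by p4.
  have H2 : P4 e w c u v' by p4.
  have p1 : partner e w c u v v' by partners.
  have p2 : partner e w c u v' v by partners.
  apply: (near_universal_endgame cw cu uv uv' vv' _ _ _ ncv _ ecc);
    rewrite 1?e_sym // => x xL.
  have [xwv xcu xwc] := tidy_trace H1 p1 xL.
  have [|xwv' _ _] := tidy_trace H2 p2 (x := x).
    move: xL; rewrite !inE !negb_or => /and5P[-> -> -> -> ->]; exact: isT.
  have nxv : ~~ e x v.
    apply/negP => xv; have xw : e x w by rewrite xwv.
    have E : x = u by apply: (unique v); rewrite // e_sym xwc.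
    by rewrite E !inE eqxx !orbT in xL.
  by split; rewrite -?xwv' ?xwv ?xcu // (negbTE nxv).
(* Now a non-neighbour of [c] has a single neighbour in the neighbourhood of [c] and none outside
   it, so it is a leaf. *)
exists c => v vc; have [cv|ncv] := boolP (e c v); first by left.
right; have [u cu uv] := ecc v vc ncv; exists u => // x /=.
have [->|xu] := eqVneq x u; first by rewrite e_sym.
apply/negP => vx; have xc : x != c by neq.
have [cx|ncx] := boolP (e c x).
  by case/eqP: xu; apply: (unique v); rewrite // e_sym.
case/negP: no_far; apply/existsP; exists v; apply/existsP; exists x.
by rewrite /far_edge vc ncv xc ncx vx.
Qed.
End Classification.

(** * From a near universal vertex to a tree 2-spanner *)

Lemma ucycle_two_neighbors (T : finType) (f : rel T) (p : seq T) x :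
  symmetric f -> ucycle f p -> 2 < size p -> x \in p ->
  exists y z, [/\ y \in p, z \in p, y != z, f x y & f x z].
Proof.
move=> f_sym /andP[fp Up] sp /rot_to[i q pE].
have mem_p y : y \in x :: q -> y \in p by rewrite -pE mem_rot.
move: fp Up sp; rewrite -(rot_cycle i) -(rot_uniq i) -(size_rot i) pE.
case: q {pE} mem_p => [|y [|z q]] //= mem_p.
rewrite rcons_path => /and3P[fxy _ /andP[_ flast]] /and4P[_ ynq _ _] _.
exists y, (last z q); split=> //; last by rewrite f_sym.
- by apply: mem_p; rewrite !inE eqxx orbT.
- by apply: mem_p; rewrite in_cons [_ \in y :: _]in_cons mem_last !orbT.
- by apply: contraNneq ynq => ->; rewrite mem_last.
Qed.

Section Sufficiency.
Variables (T : finType) (e : rel T).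
Hypotheses (e_sym : symmetric e) (e_irr : irreflexive e).

Lemma near_universal_admissible c : near_universal e c -> admissible 2 e.
Proof.
move=> cP; pose far x := (x != c) && ~~ e c x.
have farP v : far v -> exists2 u, e c u & e v =1 pred1 u.
  by case/andP=> /cP[->|].
pose f x y := e x y && [|| x == c, y == c, far x | far y].
have f_sym : symmetric f.
  by move=> x y; rewrite /f e_sym orbCA; congr (_ && (_ || (_ || _))); rewrite orbC.
exists f; split; first split=> //.
- by move=> x; rewrite /f e_irr.
- have to_c x : connect f x c.
    have [->|xc] := eqVneq x c; first exact: connect0.
    have near u : e c u -> connect f u c.
      by move=> cu; apply: connect1; rewrite /f e_sym cu eqxx orbT.
    have [/near//|ncx] := boolP (e c x).
    have fx : far x by rewrite /far xc.
    have [u cu xE] := farP x fx; apply: connect_trans (near u cu).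
    by apply: connect1; rewrite /f xE /= eqxx fx !orbT.
  move=> x y; apply: connect_trans (to_c x) _.
  by rewrite (sym_connect_sym f_sym).
(* Each vertex of a longer cycle has two distinct neighbours on it. Hence no far leaf lies on it,
   any vertex other than [c] could only be joined to [c], and so [c] alone is left. *)
- move=> p fp; rewrite leqNgt; apply/negP => sp.
  have two x := ucycle_two_neighbors f_sym fp sp (x := x).
  have not_far x : x \in p -> ~~ far x.
    move=> /two[y [z [_ _ yz /andP[xy _] /andP[xz _]]]].
    apply/negP => /farP[u _ xE]; move: xy xz; rewrite !xE /= => /eqP yE /eqP zE.
    by rewrite yE zE eqxx in yz.
  have only_c x : x \in p -> x = c.
    move=> xp; apply/eqP; apply: contraT => xc.
    have [y [z [yp zp yz /andP[_ fy] /andP[_ fz]]]] := two x xp.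
    move: fy fz; rewrite (negbTE xc) (negbTE (not_far x xp)) !(negbTE (not_far _ _)) //=.
    by rewrite !orbF => /eqP yE /eqP zE; rewrite yE zE eqxx in yz.
  case: p fp sp two only_c {not_far} => [//|x p] _ _ two only_c.
  have [|y [z [yp zp yz _ _]]] := two x; first exact: mem_head.
  by rewrite (only_c y yp) (only_c z zp) eqxx in yz.
- by move=> x y /andP[].
move=> u v uv.
have small (s : seq T) : uniq s -> size s <= #|T|.
  by move=> /card_uniqP <-; apply: max_card.
have uv' : u != v := edge_neq e_irr uv.
have [fuv|] := boolP (f u v).
  apply: (@leq_trans 1) => //; apply: (@path_gdist _ f u [:: v]).
    by rewrite /= fuv.
  by apply: (small [:: u; v]); rewrite /= inE uv'.
rewrite /f uv /= !negb_or !negb_and !negbK.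
case/and4P=> uc vc; rewrite (negbTE uc) (negbTE vc) /= => cu cv.
apply: (@path_gdist _ f u [:: c; v]).
  by rewrite /= /f e_sym cu cv !eqxx ?orbT.
by apply: (small [:: u; c; v]); rewrite /= !inE negb_or uc uv' eq_sym vc.
Qed.
End Sufficiency.

(** * Programs *)

Section Execution.
Variable W : nat.

(** Quantifying over the pending commands [K] makes runs composable; [t] is only an upper bound, so
    branches of different lengths can share it. *)
Definition halts (c : cmd) (s : state) (t : nat) (Q : state -> Prop) :=
  exists k s', [/\ k <= t, Q s' & forall K, iter k (step W) (c :: K, s) = (K, s')].

Lemma halts_weaken c s t t' (Q Q' : state -> Prop) :
  halts c s t Q -> t <= t' -> (forall s', Q s' -> Q' s') -> halts c s t' Q'.
Proof.
move=> [k [s' [kt Qs' E]]] tt' QQ'; exists k, s'; split=> //.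
- exact: leq_trans tt'.
- exact: QQ'.
Qed.

Lemma halts_skip s t (Q : state -> Prop) : Q s -> halts CSkip s t.+1 Q.
Proof. by exists 1, s. Qed.

Lemma halts_set_reg i a s t (Q : state -> Prop) :
  Q (State (upd (regs s) i (eval W s a)) (cells s)) ->
  halts (CSetReg i a) s t.+1 Q.
Proof. by move=> Qs; exists 1; eexists; split; [|exact: Qs|]. Qed.

Lemma halts_set_mem a b s t (Q : state -> Prop) :
  Q (State (regs s) (upd (cells s) (eval W s a) (eval W s b))) ->
  halts (CSetMem a b) s t.+1 Q.
Proof. by move=> Qs; exists 1; eexists; split; [|exact: Qs|]. Qed.

Lemma halts_seq c1 c2 s t1 t2 (Q : state -> Prop) :
  halts c1 s t1 (fun s1 => halts c2 s1 t2 Q) ->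
  halts (CSeq c1 c2) s (t1 + t2).+1 Q.
Proof.
move=> [k1 [s1 [kt1 [k2 [s2 [kt2 Qs2 E2]]] E1]]].
exists (k2 + k1).+1, s2; split=> // [|K]; first by rewrite ltnS addnC leq_add.
by rewrite iterSr iterD /= E1 E2.
Qed.

Lemma halts_if a c1 c2 s t (Q : state -> Prop) :
  halts (if eval W s a != 0 then c1 else c2) s t Q ->
  halts (CIf a c1 c2) s t.+1 Q.
Proof.
move=> [k [s' [kt Qs' E]]]; exists k.+1, s'; split=> // K.
by rewrite iterSr /= E.
Qed.

(** Each round costs one step for the test, and the last, failing test costs one more. *)
Lemma halts_while (I : nat -> state -> Prop) n a c t s :
  (forall i s1, i < n -> I i s1 -> eval W s1 a != 0 /\ halts c s1 t (I i.+1)) ->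
  (forall s1, I n s1 -> eval W s1 a = 0) ->
  I 0 s -> halts (CWhile a c) s (n * t.+1).+1 (I n).
Proof.
move=> body stop I0.
suff gen d i s1 : I i s1 -> i <= n -> n - i = d ->
    halts (CWhile a c) s1 (d * t.+1).+1 (I n) by exact: gen I0 _ (subn0 n).
elim: d i s1 {s I0} => [|d IH] i s Ii le_in dE.
  have iE : i = n by apply/eqP; rewrite eqn_leq le_in -subn_eq0 dE.
  rewrite iE in Ii; exists 1, s; split=> // K.
  by rewrite /= stop.
have lt_in : i < n by rewrite -subn_gt0 dE.
have [test [k [s1 [kt Is1 E]]]] := body i s lt_in Ii.
have dE' : n - i.+1 = d by rewrite subnS dE.
have [k' [s2 [kt' Is2 E']]] := IH i.+1 s1 Is1 lt_in dE'.
exists (k' + k).+1, s2; split=> // [|K].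
  by rewrite mulSn addSn ltnS addnC -addnS leq_add.
by rewrite iterSr iterD /= test E E'.
Qed.

Lemma run_halts c s t (Q : state -> Prop) : halts c s t Q ->
  exists s', run W t c s = ([::], s') /\ Q s'.
Proof.
move=> [k [s' [kt Qs' E]]]; exists s'; split=> //.
rewrite /run -(subnK kt) iterD E.
by elim: (t - k) => //= d ->.
Qed.
End Execution.

(** * The decision program and its loop invariants *)

Definition deg_at a :=
  ESub (EMem (EAdd (ELit 2) a)) (EMem (EAdd (ELit 1) a)).
(** By truncation one summand vanishes: the sum is the distance from [a] to 1. *)
Definition not_one a := EAdd (ESub a (ELit 1)) (ESub (ELit 1) a).
(* The cells following the input are zero and serve as one counter per vertex. *)
Definition counter_addr a := EAdd (EMem (EAdd (ELit 1) (EMem (ELit 0)))) a.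
Definition incr r := CSetReg r (EAdd (EReg r) (ELit 1)).
Definition more := ESub (EMem (ELit 0)) (EReg 1).

(* Register 1 holds the current vertex v, register 2 the number of leaves
   attached to non-leaves, register 4 the neighbour of v, register 5 its score. *)
Definition count_body :=
  CSeq (CIf (not_one (deg_at (EReg 1))) CSkip
    (CSeq (CSetReg 4 (EMem (EMem (EAdd (ELit 1) (EReg 1)))))
    (CIf (not_one (deg_at (EReg 4)))
      (CSeq (incr 2) (CSetMem (counter_addr (EReg 4))
                        (EAdd (EMem (counter_addr (EReg 4))) (ELit 1))))
      CSkip)))
  (incr 1).

(** The last test computes [n - 1] minus the score, truncated, which is zero on success; hence the
    answer is set in the second branch. *)
Definition search_body :=
  CSeq (CSetReg 5 (deg_at (EReg 1)))
  (CSeq (CIf (not_one (EReg 5))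
          (CSetReg 5 (EAdd (EReg 5)
                       (ESub (EReg 2) (EMem (counter_addr (EReg 1))))))
          CSkip)
  (CSeq (CIf (ESub (ESub (EMem (ELit 0)) (ELit 1)) (EReg 5))
          CSkip (CSetReg 0 (ELit 1)))
  (incr 1))).

(** Register 0 starts at [1 - n], which is nonzero only for the empty graph, where the answer is
    yes. *)
Definition decider :=
  CSeq (CSetReg 0 (ESub (ELit 1) (EMem (ELit 0))))
  (CSeq (CWhile more count_body)
  (CSeq (CSetReg 1 (ELit 0))
  (CWhile more search_body))).

Section Decider.
Variables (W n base : nat) (m0 dg nb : nat -> nat).
Hypotheses (m0_size : m0 0 = n) (m0_end : m0 n.+1 = base).
Hypotheses (base_gt : n.+1 < base) (W_gt : base + n.+2 <= W).
Hypothesis m0_deg : forall v, v < n -> m0 v.+2 - m0 v.+1 = dg v.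
Hypothesis dg_lt : forall v, v < n -> dg v < n.
Hypothesis m0_nb : forall v, v < n -> dg v = 1 ->
  [/\ m0 (m0 v.+1) = nb v, nb v < n & m0 v.+1 < base].
Hypothesis m0_zero : forall u, u < n -> m0 (base + u) = 0.

Definition attached i := (dg i == 1) && (dg (nb i) != 1).
Definition leaves k := count attached (iota 0 k).
Definition hits k u := count (fun i => attached i && (nb i == u)) (iota 0 k).
(** The leaves attached to [c] are already counted in its degree, so [hits] takes them away. *)
Definition score c := dg c + (if dg c != 1 then leaves n - hits n c else 0).

Lemma count_iotaS (P : pred nat) k : count P (iota 0 k.+1) = count P (iota 0 k) + P k.
Proof. by rewrite -addn1 iotaD count_cat /= addn0. Qed.

Lemma leaves_le k : leaves k <= k.
Proof. by rewrite /leaves -{2}(size_iota 0 k) count_size. Qed.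

Lemma hits_le k u : hits k u <= k.
Proof. by rewrite /hits -{2}(size_iota 0 k) count_size. Qed.

Lemma small k : k <= n.+3 -> k %% W = k.
Proof.
move=> kn; apply: modn_small; apply: leq_trans W_gt; apply: leq_ltn_trans kn _.
by rewrite -[n.+4]/(2 + n.+2) leq_add2r (leq_trans _ base_gt).
Qed.

Definition mem_ok (q : nat -> nat) (s : state) :=
  (forall j, j < base -> cells s j = m0 j) /\
  (forall u, u < n -> cells s (base + u) = q u).

Section Evaluation.
Variables (q : nat -> nat) (s : state).
Hypothesis ok : mem_ok q s.

Lemma cell_low j : j <= n.+1 -> cells s j = m0 j.
Proof. by move=> jn; apply: ok.1; apply: leq_ltn_trans base_gt. Qed.

Lemma eval_size : eval W s (EMem (ELit 0)) = n.
Proof. by rewrite /= small // cell_low // m0_size. Qed.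

Lemma eval_more : eval W s more = n - regs s 1.
Proof. by rewrite /more -eval_size. Qed.

Lemma eval_deg a v : eval W s a = v -> v < n -> eval W s (deg_at a) = dg v.
Proof.
move=> /= -> vn; rewrite (small (k := 2)) // (small (k := 1)) // add1n add2n.
have vn1 : v.+1 <= n.+1 by rewrite ltnS ltnW.
rewrite (small (k := v.+2)); last by rewrite ltnS (leq_trans vn1) // leqW.
by rewrite (small (k := v.+1)) ?(leq_trans vn1) 2?leqW // !cell_low // m0_deg.
Qed.

Lemma eval_not_one a : eval W s a <= n ->
  (eval W s (not_one a) != 0) = (eval W s a != 1).
Proof.
move=> an; rewrite /= !(small (k := 1)) // small.
  by case: (eval W s a) => [|[|k]].
case: (eval W s a) an => [|k] kn //.
by rewrite !subSS subn0 sub0n addn0; do 3!apply: leqW; apply: ltnW.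
Qed.

Lemma eval_counter_addr a u : eval W s a = u -> u < n ->
  eval W s (counter_addr a) = base + u.
Proof.
have sz : cells s (0 %% W) = n := eval_size.
move=> /= -> un; rewrite sz.
rewrite (small (k := 1)) // add1n (small (k := n.+1)); last by do 2!apply: leqW.
rewrite cell_low // m0_end modn_small //; apply: leq_trans W_gt.
by rewrite ltn_add2l; do 2!apply: leqW.
Qed.

Lemma eval_incr r : regs s r <= n -> eval W s (EAdd (EReg r) (ELit 1)) = (regs s r).+1.
Proof.
by move=> rn; rewrite /= (small (k := 1)) // addn1 small // ltnW // ltnW.
Qed.
End Evaluation.

Definition counting k s :=
  [/\ regs s 1 = k, regs s 2 = leaves k, regs s 0 = 1 - n & mem_ok (hits k) s].

(** Nine steps is the length of the longest branch, where [k] is an attached leaf. *)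
Lemma count_step k s : k < n -> counting k s ->
  halts W count_body s 9 (counting k.+1).
Proof.
move=> kn [s1 s2 s0 ok].
have finish s' (ok' : mem_ok (hits k.+1) s') : regs s' 0 = 1 - n -> regs s' 1 = k ->
    regs s' 2 = leaves k.+1 -> halts W (incr 1) s' 1 (counting k.+1).
  move=> s0' s1' s2'; apply: halts_set_reg.
  by rewrite eval_incr s1' ?(ltnW kn).
have skip : ~~ attached k -> mem_ok (hits k.+1) s /\ regs s 2 = leaves k.+1.
  move=> /negbTE nk; rewrite /leaves count_iotaS nk addn0 -/(leaves k); split=> //.
  split=> [|u un]; first exact: ok.1.
  by rewrite ok.2 // /hits count_iotaS /= nk addn0.
have eval_k : eval W s (EReg 1) = k by [].
apply: (@halts_seq _ _ _ _ 7 1); apply: halts_if.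
have Ed := eval_deg ok eval_k kn.
rewrite eval_not_one Ed; last exact: ltnW (dg_lt kn).
have [dk|dk] /= := eqVneq (dg k) 1; last first.
  have [|ok' s2'] := skip; first by rewrite /attached (negbTE dk).
  by apply: halts_skip; apply: finish.
have [nbE nbn addr] := m0_nb kn dk.
apply: (@halts_seq _ _ _ _ 1 4); apply: halts_set_reg.
have -> : eval W s (EMem (EMem (EAdd (ELit 1) (EReg 1)))) = nb k.
  rewrite /= (small (k := 1)) // s1 add1n small; last by do 3!apply: leqW.
  by rewrite (cell_low ok (j := k.+1)) ?ok.1 // ltnS ltnW.
set s' := State _ _; have ok' : mem_ok (hits k) s' by [].
have eval_4 : eval W s' (EReg 4) = nb k by [].
apply: halts_if; have Ed' := eval_deg ok' eval_4 nbn.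
rewrite eval_not_one Ed'; last exact: ltnW (dg_lt nbn).
have [dnb|dnb] /= := eqVneq (dg (nb k)) 1.
  have [|ok'' s2'] := skip; first by rewrite /attached dnb eqxx andbF.
  by apply: halts_skip; apply: finish.
have ak : attached k by rewrite /attached dk dnb.
apply: (@halts_seq _ _ _ _ 1 1); apply: halts_set_reg.
rewrite eval_incr; last by rewrite /= /upd /= s2 (leq_trans (leaves_le k)) // ltnW.
set s'' := State _ _; have ok'' : mem_ok (hits k) s'' by [].
have eval_4' : eval W s'' (EReg 4) = nb k by [].
apply: halts_set_mem.
have cE : eval W s'' (EMem (counter_addr (EReg 4))) = hits k (nb k).
  by rewrite -(ok''.2 _ nbn) -(eval_counter_addr ok'' eval_4' nbn).
have -> : eval W s'' (EAdd (EMem (counter_addr (EReg 4))) (ELit 1)) =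
    (hits k (nb k)).+1.
  rewrite -cE [LHS]/= -/(eval W s'' (EMem (counter_addr (EReg 4)))) cE.
  rewrite (small (k := 1)) // addn1 small // ltnS (leq_trans (hits_le _ _)) //.
  by do 2!apply: leqW; apply: ltnW.
rewrite (eval_counter_addr ok'' eval_4' nbn).
apply: finish => //=; last first.
  by rewrite /upd /= s2 /leaves count_iotaS ak addn1.
split=> [j jb|u un] /=.
  rewrite /upd ltn_eqF ?ok.1 //; exact: leq_trans jb (leq_addr _ _).
rewrite /upd eqn_add2l /hits count_iotaS ak /= eq_sym.
by case: eqP => [->|_]; rewrite ?addn1 // addn0 ok.2.
Qed.

Definition searching k s :=
  [/\ regs s 1 = k, regs s 2 = leaves n,
      (regs s 0 != 0) = (n == 0) || has (fun c => n.-1 <= score c) (iota 0 k)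
    & mem_ok (hits n) s].

Lemma search_step k s : k < n -> searching k s ->
  halts W search_body s 9 (searching k.+1).
Proof.
move=> kn [s1 s2 s0 ok].
have eval_k : eval W s (EReg 1) = k by [].
apply: (@halts_seq _ _ _ _ 1 7); apply: halts_set_reg.
rewrite (eval_deg ok eval_k kn).
set s' := State _ _; have ok' : mem_ok (hits n) s' by [].
apply: (@halts_seq _ _ _ _ 2 4).
have dkn := ltnW (dg_lt kn).
suff scored : halts W (CIf (not_one (EReg 5))
    (CSetReg 5 (EAdd (EReg 5) (ESub (EReg 2) (EMem (counter_addr (EReg 1))))))
    CSkip) s' 2 (fun s => [/\ regs s 1 = k, regs s 2 = leaves n, regs s 5 = score k,
      (regs s 0 != 0) = (n == 0) || has (fun c => n.-1 <= score c) (iota 0 k)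
    & mem_ok (hits n) s]).
  apply: halts_weaken scored _ _ => // {s s1 s2 s0 ok eval_k s' ok'} s.
  move=> [s1 s2 s5 s0 ok]; apply: (@halts_seq _ _ _ _ 2 1); apply: halts_if.
  have hasS : has (fun c => n.-1 <= score c) (iota 0 k.+1) =
      has (fun c => n.-1 <= score c) (iota 0 k) || (n.-1 <= score k).
    by rewrite -addn1 iotaD has_cat /= orbF.
  have -> : eval W s (ESub (ESub (EMem (ELit 0)) (ELit 1)) (EReg 5)) = n.-1 - score k.
    by rewrite -s5 -subn1 -(eval_size ok) /= (small (k := 1)).
  rewrite subn_eq0; case: leqP => sk.
    apply: halts_set_reg; apply: halts_set_reg; rewrite /searching hasS; split=> //=.
      by rewrite /upd /= (small (k := 1)) // s1 addn1 small // ltnW // ltnW // ltnW.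
    by rewrite /upd /= (small (k := 1)) // sk !orbT.
  apply: halts_skip; apply: halts_set_reg; rewrite /searching hasS; split=> //=.
    by rewrite /upd /= (small (k := 1)) // s1 addn1 small // ltnW // ltnW // ltnW.
  by rewrite /upd /= s0 [_ <= score k]leqNgt sk orbF.
apply: halts_if; rewrite eval_not_one //.
rewrite [eval _ _ _]/= /upd /=; case: ifPn => dk; last first.
  by apply: halts_skip; split=> //=; rewrite /upd /= /score (negbTE dk) addn0.
apply: halts_set_reg; split=> //=; rewrite /upd /=.
have E : eval W s' (EMem (counter_addr (EReg 1))) = hits n k.
  have eval_k' : eval W s' (EReg 1) = k by [].
  by rewrite -(ok'.2 _ kn) -(eval_counter_addr ok' eval_k' kn).
rewrite -[cells s _]/(eval W s' (EMem (counter_addr (EReg 1)))) E s2.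
rewrite /score dk modn_small //.
(* The sum is at most [2n], so the addition does not wrap around. *)
apply: leq_ltn_trans (leq_add dkn (leq_subr _ _)) _.
apply: leq_ltn_trans (leq_add (leqnn n) (leaves_le n)) _.
apply: leq_trans W_gt; apply: leq_trans (_ : n + n.+1 <= _); first by rewrite addnS.
by apply: leq_add; rewrite // ltnW // ltnW.
Qed.

Lemma decider_correct s : (forall i, regs s i = 0) -> cells s =1 m0 ->
  halts W decider s (20 * n.+1)
    (fun s' => (regs s' 0 != 0) = (n == 0) || has (fun c => n.-1 <= score c) (iota 0 n)).
Proof.
move=> regs0 cells0.
have ok0 : mem_ok (hits 0) s by split=> [j _|u un]; rewrite cells0 // m0_zero.
(* Each loop takes at most [10n + 1] steps; three sequencings and two assignments bring the total to
   [20n + 7]. *)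
apply: (halts_weaken (t := (1 + (n * 10).+1 + (1 + (n * 10).+1).+1).+2)); last by move=> s'; exact.
  apply: (@halts_seq _ _ _ _ 1 ((n * 10).+1 + (1 + (n * 10).+1).+1).+1).
  apply: halts_set_reg.
  apply: halts_seq.
  apply: halts_weaken (halts_while (I := counting) (n := n) (t := 9) _ _ _) _ _ => //.
  - move=> i s1 lt_in H; split; last exact: count_step.
    by case: H => s1E _ _ ok; rewrite (eval_more ok) s1E -lt0n subn_gt0.
  - by move=> s1 [s1E _ _ ok]; rewrite (eval_more ok) s1E subnn.
  - split; rewrite //= /upd /= ?regs0 //.
    by have := eval_size ok0; rewrite /= => ->; rewrite (small (k := 1)).
  move=> s1 [_ s12 s10 ok1]; apply: halts_seq; apply: halts_set_reg.
  apply: halts_weaken (halts_while (I := searching) (n := n) (t := 9) _ _ _) _ _ => //.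
  - move=> i s2 lt_in H; split; last exact: search_step.
    by case: H => s1E _ _ ok; rewrite (eval_more ok) s1E -lt0n subn_gt0.
  - by move=> s2 [s1E _ _ ok]; rewrite (eval_more ok) s1E subnn.
  - split; rewrite //= /upd /= ?(small (k := 0)) //.
    by rewrite s10 orbF subn_eq0 -ltnNge ltnS leqn0.
  by move=> s2 [].
rewrite !addSn !addnS add0n -mulnDr [n * _]mulnC [20 * _]mulnS.
by rewrite -[X in X < _]/(6 + 20 * n) ltn_add2r.
Qed.
End Decider.

(** * Counting leaves *)

Section Counting.
Variables (T : finType) (e : rel T).
Hypotheses (e_sym : symmetric e) (e_irr : irreflexive e).

Definition nbrs v := [set u | e v u].

(* A vertex c of degree 1 must not count itself, hence the first condition. *)
Definition attached_leaves c := [set v | (#|nbrs c| != 1) &&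
  [exists u, [&& e v u, #|nbrs v| == 1, #|nbrs u| != 1 & u != c]]].

Lemma nbrs1P v u : e v u -> #|nbrs v| = 1 -> e v =1 pred1 u.
Proof.
move=> vu /eqP/cards1P[w E] x.
have : u \in nbrs v by rewrite inE.
by rewrite E inE => /eqP->; have := in_set1 x w; rewrite -E inE.
Qed.

Lemma card_nbrs1 v u : e v =1 pred1 u -> #|nbrs v| = 1.
Proof.
by move=> vE; apply/eqP/cards1P; exists u; apply/setP=> x; rewrite !inE vE.
Qed.

(** The neighbours of [c] and the leaves attached elsewhere are disjoint and omit [c], so the
    inequality says that they cover all other vertices. *)
Lemma near_universal_card :
  (exists c, near_universal e c) <->
  (exists c, #|T|.-1 <= #|nbrs c| + #|attached_leaves c|).
Proof.
split=> [[c cP]|[c]].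
  (* If [c] has degree 1, every vertex other than its neighbour [u] is adjacent to [u], and the
     degree of [u] alone suffices. *)
  have [dc|dc] := eqVneq #|nbrs c| 1.
    have /eqP/cards1P[u E] := dc.
    have cE x : e c x = (x == u).
      by have := in_set1 x u; rewrite -E inE.
    exists u; apply: leq_trans (leq_addr _ _); rewrite -(cardsC1 u).
    apply/subset_leq_card/subsetP => v; rewrite !inE => vu; rewrite e_sym.
    have [->|vc] := eqVneq v c; first by rewrite cE.
    case: (cP v vc) => [|[u' cu' ->]]; first by rewrite cE (negbTE vu).
    by rewrite cE in cu'; rewrite /= eq_sym.
  exists c; rewrite -(cardsC1 c); apply: leq_trans (leq_card_setU _ _).
  apply/subset_leq_card/subsetP => v; rewrite !inE => vc; rewrite dc /=.
  case: (cP v vc) => [->//|[u cu vE]]; apply/orP; right.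
  apply/existsP; exists u; rewrite vE /= eqxx (card_nbrs1 vE) eqxx.
  rewrite [u == c]eq_sym (edge_neq e_irr cu) andbT /=.
  apply: contraNN vc => /eqP du.
  have uv : e u v by rewrite e_sym vE /=.
  by have := nbrs1P uv du c; rewrite e_sym cu eq_sym.
move=> le; exists c => v vc.
have sub : nbrs c :|: attached_leaves c \subset [set~ c].
  apply/subsetP => x; rewrite !inE => /orP[|/andP[dc /existsP[u]]].
    by rewrite eq_sym; apply: edge_neq.
  by case/and4P=> _ dx _ _; apply: contraNneq dc => <-.
have dis : [disjoint nbrs c & attached_leaves c].
  rewrite -setI_eq0; apply/eqP/setP=> x; rewrite !inE; apply/negP.
  case/and3P=> cx _ /existsP[u /and4P[xu /eqP dx _ uc]].
  by have := nbrs1P xu dx c; rewrite e_sym cx /= eq_sym (negbTE uc).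
have all_x x : x != c -> (x \in nbrs c) || (x \in attached_leaves c).
  move=> xc; have /eqP/setP/(_ x) : nbrs c :|: attached_leaves c == [set~ c].
    by rewrite eqEcard sub cardsC1 cardsU (disjoint_setI0 dis) cards0 subn0.
  by rewrite in_setU => ->; rewrite !inE.
case/orP: (all_x v vc); rewrite !inE; first by left.
case/andP=> dc /existsP[u /and4P[vu /eqP dv du uc]]; right.
exists u; last exact: nbrs1P.
(* Not having degree 1, [u] is no attached leaf, so it is a neighbour of [c]. *)
case/orP: (all_x u uc); rewrite !inE // => /andP[_ /existsP[w /and4P[_ du' _ _]]].
by rewrite du' in du.
Qed.
End Counting.

(** * Reading degrees and leaf neighbours off the encoded input *)

Lemma count_iota_card n (P : pred nat) : count P (iota 0 n) = #|[set i : 'I_n | P i]|.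
Proof.
rewrite cardsE cardE /enum_mem -enumT size_filter -val_enum_ord count_map.
exact: eq_count.
Qed.

Lemma sumn_bound m (s : seq nat) : all (fun k => k <= m) s -> sumn s <= size s * m.
Proof. by elim: s => //= k s IH /andP[km /IH sm]; rewrite mulSn leq_add. Qed.

Section Encoding.
Variables (n : nat) (e : rel 'I_n) (adj : 'I_n -> seq 'I_n).
Hypotheses (e_sym : symmetric e) (e_irr : irreflexive e).
Hypothesis adjP : adjacency_lists e adj.

Let lists := [seq map val (adj v) | v <- enum 'I_n].
Let sizes := map size lists.
Let m0 := nth 0 (encode adj).

Definition degree v := nth 0 sizes v.
(** Meant for leaves, whose list has one entry whatever the order of [adj]. *)
Definition neighbor v := head 0 (nth [::] lists v).

Lemma size_lists : size lists = n. Proof. by rewrite size_map size_enum_ord. Qed.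
Lemma size_sizes : size sizes = n. Proof. by rewrite size_map size_lists. Qed.

Lemma nth_lists (v : 'I_n) : nth [::] lists v = map val (adj v).
Proof. by rewrite (nth_map v) ?size_enum_ord // nth_ord_enum. Qed.

Lemma degree_card (v : 'I_n) : degree v = #|nbrs e v|.
Proof.
have [Uv vE] := adjP v.
rewrite /degree (nth_map [::]) ?size_lists // nth_lists size_map -(card_uniqP Uv).
by apply: eq_card => u; rewrite vE inE.
Qed.

Lemma neighbor_val (v u : 'I_n) : e v =1 pred1 u -> neighbor v = u.
Proof.
move=> vE; have [Uv adjE] := adjP v; rewrite /neighbor nth_lists.
have : size (adj v) = 1.
  rewrite -(card_uniqP Uv) -(card1 u); apply: eq_card => x.
  by rewrite adjE vE.
case: (adj v) adjE => [|x [|//]] // adjE _ /=.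
by have := adjE x; rewrite mem_head vE => /esym/eqP->.
Qed.

Definition offset v := sumn (take v sizes).

Lemma encode_head : m0 0 = n. Proof. by []. Qed.

Lemma encodeS j : m0 j.+1 =
  nth 0 ([seq n.+2 + offset v | v <- iota 0 n.+1] ++ flatten lists) j.
Proof. by []. Qed.

Lemma encode_offset v : v <= n -> m0 v.+1 = n.+2 + offset v.
Proof.
move=> vn; rewrite encodeS nth_cat size_map size_iota ltnS vn.
by rewrite (nth_map 0) ?size_iota // nth_iota.
Qed.

Lemma encode_list k : m0 (n.+2 + k) = nth 0 (flatten lists) k.
Proof.
rewrite -[n.+2 + k]/((n.+1 + k).+1) encodeS nth_cat size_map size_iota.
by rewrite ltnNge leq_addr addKn.
Qed.

Lemma offsetS v : v < n -> offset v.+1 = offset v + degree v.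
Proof.
by move=> vn; rewrite /offset (take_nth 0) ?size_sizes // sumn_rcons.
Qed.

Lemma offset_end : offset n = sumn sizes.
Proof. by rewrite /offset -size_sizes take_size. Qed.

Lemma degree_lt v : v < n -> degree v < n.
Proof.
move=> vn; rewrite -[v]/(val (Ordinal vn)) degree_card.
rewrite -[X in _ < X]card_ord -cardsT; apply: proper_card; apply/properP.
by split; [exact: subsetT|exists (Ordinal vn); rewrite ?inE ?e_irr].
Qed.

Lemma encode_neighbor v : v < n -> degree v = 1 ->
  [/\ m0 (m0 v.+1) = neighbor v, neighbor v < n & m0 v.+1 < m0 n.+1].
Proof.
move=> vn dv.
have [u [vu uE]] : exists u : 'I_n, neighbor v = u /\ nth [::] lists v = [:: val u].
  pose v' := Ordinal vn; have := dv; rewrite -[v]/(val v') degree_card.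
  move/eqP/cards1P=> [u E].
  have [Uv adjE] := adjP v'.
  have vE : e v' =1 pred1 u by move=> x; have := in_set1 x u; rewrite -E inE.
  exists u; split; first exact: neighbor_val.
  rewrite nth_lists; have : size (adj v') = 1.
    rewrite -(card_uniqP Uv) -(card1 u); apply: eq_card => x.
    by rewrite adjE vE.
  case: (adj v') adjE => [|x [|//]] // adjE _ /=.
  by have := adjE x; rewrite mem_head vE => /esym/eqP->.
split; last 2 first.
- by rewrite vu.
- rewrite !encode_offset //; last exact: ltnW.
  rewrite ltn_add2l offset_end -(cat_take_drop v sizes) sumn_cat.
  rewrite -/(offset v) -[X in X < _]addn0 ltn_add2l.
  by rewrite (drop_nth 0) ?size_sizes //= -/(degree v) dv.
rewrite encode_offset ?encode_list; last exact: ltnW.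
(* The first entry of a nonempty list [v] sits at index [offset v] of the flattened lists. *)
have c0 : 0 < nth 0 (shape lists) v by rewrite -/(degree v) dv.
have := flatten_indexKl c0; have := flatten_indexKr c0.
rewrite /flatten_index addn0 -/(offset v) => Er El.
by rewrite nth_flatten El Er uE vu.
Qed.

(** Beyond the input [nth] returns its default 0, the initial value of the counters. *)
Lemma encode_out u : m0 (m0 n.+1 + u) = 0.
Proof.
rewrite encode_offset // offset_end -addnA encode_list nth_default //.
by rewrite size_flatten leq_addr.
Qed.

(** There are [n + 2] header cells and at most [n * n] list entries, so a square bounds all
    addresses with room for the counters. *)
Lemma encode_end_bound : m0 n.+1 + n.+2 <= n.+2 ^ 2.
Proof.
rewrite encode_offset // offset_end.
have : sumn sizes <= n * n.
  rewrite -{1}size_sizes; apply: sumn_bound; apply/(all_nthP 0) => i.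
  by rewrite size_sizes => /degree_lt/ltnW.
move=> le; rewrite -mulnn mulSn -addnA leq_add2l addnC mulSn leq_add2l.
by rewrite (leq_trans le) // leq_mul2l -addn2 leq_addr orbT.
Qed.

Lemma score_card (c : 'I_n) :
  score n degree neighbor c = #|nbrs e c| + #|attached_leaves e c|.
Proof.
rewrite /score degree_card; congr (_ + _).
have [dc|dc] := eqVneq #|nbrs e c| 1.
  rewrite /= (_ : attached_leaves e c = set0) ?cards0 //.
  by apply/setP=> v; rewrite !inE dc eqxx.
rewrite /= /leaves /hits !count_iota_card.
have -> : attached_leaves e c = [set i : 'I_n | attached degree neighbor i]
    :\: [set i : 'I_n | attached degree neighbor i && (neighbor i == c)].
  apply/setP=> v; rewrite !inE dc /= /attached degree_card.
  apply/existsP/idP => [[u /and4P[vu /eqP dv du uc]]|].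
    have uE := neighbor_val (nbrs1P vu dv).
    by rewrite uE degree_card dv du eqxx /= uc.
  case: eqP => [/eqP/cards1P[u E]|//].
  have vE : e v =1 pred1 u by move=> x; have := in_set1 x u; rewrite -E inE.
  rewrite (neighbor_val vE) degree_card /= => /andP[H du]; rewrite du /= in H.
  by exists u; rewrite vE /= eqxx du.
by rewrite cardsD; congr (_ - _); apply: eq_card => v; rewrite !inE andbA andbb.
Qed.

Lemma admissible_score : P4_tidy e ->
  admissible 2 e <->
  (n == 0) || has (fun c => n.-1 <= score n degree neighbor c) (iota 0 n).
Proof.
move=> tidy.
have scoreP : (exists c : 'I_n, near_universal e c) <->
    has (fun c => n.-1 <= score n degree neighbor c) (iota 0 n).
  apply: (iff_trans (near_universal_card e_sym e_irr)); rewrite card_ord.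
  split=> [[c le]|/hasP[c]].
    apply/hasP; exists (val c); first by rewrite mem_iota /= add0n ltn_ord.
    by rewrite score_card.
  rewrite mem_iota add0n /= => cn le; exists (Ordinal cn).
  by rewrite -score_card.
split=> [[f span]|].
  have [//|n0] := eqVneq n 0; apply/scoreP.
  have n_gt0 : 0 < n by rewrite lt0n.
  exact: (near_universal_exists e_sym e_irr tidy span (Ordinal n_gt0)).
case/orP => [/eqP n0|/scoreP[c]]; last exact: near_universal_admissible.
(* Without vertices there is no near universal one, but the empty graph spans itself. *)
have no (x : 'I_n) : False by case: x => x; rewrite n0.
exists e; split=> [|//|x]; last by case: (no x).
by split=> // -[//|x p]; case: (no x).
Qed.
End Encoding.

Theorem theorem5 :
  exists (P : cmd) (a b : nat),
    forall (n : nat) (e : rel 'I_n) (adj : 'I_n -> seq 'I_n) (w : nat),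
      symmetric e -> irreflexive e -> P4_tidy e ->
      adjacency_lists e adj ->
      n.+2 ^ b <= 2 ^ w ->
      answers (run (2 ^ w) (a * n.+1) P (input_state adj)) (admissible 2 e).
Proof.
exists decider, 20, 2 => n e adj w e_sym e_irr tidy adjP le_w.
have base_gt : n.+1 < nth 0 (encode adj) n.+1.
  by rewrite encode_offset // leq_addr.
have W_gt := leq_trans (encode_end_bound e_irr adjP) le_w.
have := @decider_correct (2 ^ w) n _ _ (degree adj) (neighbor adj)
  (encode_head adj) (erefl _) base_gt W_gt _ (degree_lt e_irr adjP)
  (encode_neighbor adjP) (fun u _ => encode_out adj u) (input_state adj).
case=> // [v vn|].
  by rewrite !encode_offset ?offsetS // 1?ltnW // subnDl addKn.
move=> s' H; have [s2 [-> E]] := run_halts (ex_intro _ s' H).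
split=> //=; rewrite E; apply: iff_sym.
exact: admissible_score.
Qed.
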